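(* Let either $t=1$ and $n=0$, or $n\ge 1$ and $t=p_1p_2\cdots p_n$, where $p_1,p_2,\dots,p_n$ are odd integers (not necessarily prime or distinct) with $p_i>1$ for $1\le i\le n$. Let $m$ be a positive integer such that $4m-1$ is a prime power, or $4m-1=q(q+2)$ where both $q$ and $q+2$ are prime powers. Then there is a $((4m-1)t,2;m\cdot 2^{n+1},\frac{4mt-t-1}{2};m\cdot 2^n,m\cdot 2^n)$-GSEDF (in some abelian group of order $(4m-1)t$).
   Context: Let $G$ be a finite abelian group of order $v$, written additively with identity $0$. For disjoint subsets $A,B\subseteq G$, let $\Delta(A,B)$ be the multiset $\{x-y : x\in A, y\in B\}$. For positive integers $k_1,k_2,\lambda_1,\lambda_2$, a $(v,2;k_1,k_2;\lambda_1,\lambda_2)$-generalized strong external difference family (GSEDF) in $G$ is a pair $\{D_1,D_2\}$ of disjoint subsets of $G$ with $|D_1|=k_1$, $|D_2|=k_2$ such that $\Delta(D_1,D_2)$ contains every element of $G\setminus\{0\}$ exactly $\lambda_1$ times and $\Delta(D_2,D_1)$ contains every element of $G\setminus\{0\}$ exactly $\lambda_2$ times. *)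

(* Defs.v *)
From mathcomp Require Import all_boot all_order all_fingroup all_algebra.

Set Implicit Arguments.
Unset Strict Implicit.
Unset Printing Implicit Defensive.

Import GRing.Theory.

Definition prime_power (q : nat) : Prop :=
  exists p k : nat, [/\ prime p, 0 < k & q = p ^ k].

Section GSEDF.
Variable G : finZmodType.

(* The multiset {x - y : x in A, y in B}, as a sequence up to order; the
   multiplicity of g in it is [count_mem g]. *)
Definition Delta (A B : {set G}) : seq G :=
  [seq (x - y)%R | x <- enum A, y <- enum B].

Definition covers_nonzero (s : seq G) (lambda : nat) : Prop :=
  forall g : G, g != 0%R -> count_mem g s = lambda.

Record is_GSEDF (v k1 k2 lambda1 lambda2 : nat) (D1 D2 : {set G}) : Prop := {
  GSEDF_order : #|G| = v;
  GSEDF_pos : [/\ 0 < k1, 0 < k2, 0 < lambda1 & 0 < lambda2];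
  GSEDF_disjoint : [disjoint D1 & D2];
  GSEDF_card1 : #|D1| = k1;
  GSEDF_card2 : #|D2| = k2;
  GSEDF_Delta12 : covers_nonzero (Delta D1 D2) lambda1;
  GSEDF_Delta21 : covers_nonzero (Delta D2 D1) lambda2
}.

End GSEDF.

(* Main.v *)
(* Only the number c(g) of x in D1 with x - g in D2 matters: if |D1| = 2l, c(0) = 0
   and c(g) = l for g <> 0, double counting forces |D2| = (v - 1) / 2.  Such pairs in
   G lift to G * Z_p for odd p, because in the group ring of Z_p, with generator y,
   (1 + y) (1 - y + y^2 - ... + y^(p-1)) = 2: take D1' = D1 * {0, 1} and let the fibres
   of D2' alternate between D2 and its complement.
   For t = 1, a function f : G -> {1, -1} with autocorrelation -1 off 0 yields a pair
   of level sets: the quadratic character when |G| is a prime power (Paley), and the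
   product of two quadratic characters, modified on the axes, when |G| = q (q + 2)
   (Stanton-Sprott). *)
Require Import Defs.
From mathcomp Require Import all_boot all_order all_fingroup all_algebra.
From HB Require Import structures.
From mathcomp Require Import all_solvable all_field zify ring.

Set Implicit Arguments.
Unset Strict Implicit.
Unset Printing Implicit Defensive.

Import Order.TTheory GRing.Theory Num.Theory FinRing.Theory.

(** This joins the finite and the additive structure of a product, so that [G * H] is itself a
    [finZmodType]. *)
HB.instance Definition _ (G H : finZmodType) := GRing.Zmodule.on (G * H)%type.

(** * Multiplicities of differences *)

Section DifferenceCount.
Local Open Scope ring_scope.
Variable G : finZmodType.
Implicit Types (A B : {set G}) (g : G).

Definition diff_count A B g := #|[set x in A | x - g \in B]|.

Lemma count_mem_Delta A B g : count_mem g (Delta A B) = diff_count A B g.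
Proof.
rewrite /Delta -sum1_count big_mkcond big_allpairs_dep big_enum /=.
rewrite /diff_count -sum1_card big_mkcond [RHS]big_mkcond /=.
apply: eq_bigr => x _; rewrite inE; case: (x \in A) => //=.
rewrite big_enum big_mkcond (bigD1 (x - g)) //= subKr eqxx.
rewrite big1 ?addn0 // => y yN; case: eqP => [gE|]; last by rewrite if_same.
by rewrite -gE subKr eqxx in yN.
Qed.

(** Translation by [- g] carries one counted set onto the other. *)
Lemma diff_countC A B g : diff_count B A g = diff_count A B (- g).
Proof.
rewrite /diff_count -(card_imset _ (addIr (- g))); apply: eq_card => x.
apply/imsetP/idP => [[y]|]; rewrite !inE.
  by move=> /andP[yB yA] ->; rewrite yA opprK subrK.
by move=> /andP[xA xB]; exists (x + g); rewrite ?inE ?addrK // -{1}[g]opprK xB.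
Qed.

Lemma sum_diff_count A B : (\sum_g diff_count A B g = #|A| * #|B|)%N.
Proof.
rewrite /diff_count (eq_bigr (fun g => \sum_(x in A) (x - g \in B)%R)%N); last first.
  move=> g _; rewrite -sum1_card big_mkcond /= [RHS]big_mkcond /=.
  by apply: eq_bigr => x _; rewrite inE; case: (x \in A); case: (_ \in B).
rewrite exchange_big /= (eq_bigr (fun=> #|B|)) ?sum_nat_const // => x _.
rewrite (reindex_inj (inv_inj (subKr x))) /= -sum1_card [RHS]big_mkcond.
by apply: eq_bigr => y _; rewrite subKr; case: (y \in B).
Qed.

Lemma diff_count0 A B : diff_count A B 0 = 0%N -> [disjoint A & B].
Proof.
move/eqP; rewrite cards_eq0 => /eqP AB0; rewrite disjoint_subset.
apply/subsetP => x xA; rewrite inE; apply/negP => xB.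
by move/setP/(_ x): AB0; rewrite !inE subr0 xA xB.
Qed.

End DifferenceCount.

(** * Flat pairs: passage to GSEDFs and lifting by an odd factor *)

Definition flat_pair (G : finZmodType) (lambda : nat) (D1 D2 : {set G}) : Prop :=
  #|D1| = (2 * lambda)%N /\
  forall g : G, diff_count D1 D2 g = if g == 0%R then 0 else lambda.

(** [Delta D2 D1] comes for free, being [Delta D1 D2] read at [- g]. The bound [2 < #|G|] makes the
    size of [D2] positive. *)
Lemma flat_pair_GSEDF (G : finZmodType) (lambda : nat) (D1 D2 : {set G}) :
  0 < lambda -> 2 < #|G| -> flat_pair lambda D1 D2 ->
  is_GSEDF #|G| (2 * lambda) ((#|G| - 1) %/ 2) lambda lambda D1 D2.
Proof.
move=> l0 G2 [cD1 cD].
have E : 2 * lambda * #|D2| = (#|G| - 1) * lambda.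
  rewrite -cD1 -sum_diff_count (bigD1 0%R) //= cD eqxx add0n.
  rewrite (eq_bigr (fun=> lambda)) => [|g /negPf g0]; last by rewrite cD g0.
  by rewrite sum_nat_const cardC1 subn1.
have cD2 : #|D2| = (#|G| - 1) %/ 2 by nia.
split=> //.
- by split=> //; lia.
- by apply: diff_count0; rewrite cD eqxx.
- by move=> g /negPf g0; rewrite count_mem_Delta cD g0.
- by move=> g /negPf g0; rewrite count_mem_Delta diff_countC cD oppr_eq0 g0.
Qed.

Lemma flat_pair_step (G : finZmodType) (lambda p : nat) (D1 D2 : {set G}) :
  odd p -> 1 < p -> flat_pair lambda D1 D2 ->
  exists (G' : finZmodType) (D1' D2' : {set G'}),
    #|G'| = #|G| * p /\ flat_pair (2 * lambda) D1' D2'.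
Proof.
case: p => [|[|q]] //= q_even _ [cD1 cD].
pose H : finZmodType := 'I_q.+2.
have one_neq0 : (1%R : H) != 0%R by [].
pose E1 : {set H} := [set 0%R; 1%R].
(* The minus sign turns the height [a - h] of a difference into [h - a], so the heights 0 and 1 of
   [E1] contribute [N h] and [N (h - 1)]. *)
pose D2' : {set (G * H)%type} := [set z | (z.1 \in D2) == ~~ odd (- z.2 : H)%R].
exists (G * H)%type, (setX D1 E1), D2'.
split; first by rewrite card_prod card_ord.
split; first by rewrite cardsX cD1 cards2 eq_sym one_neq0; lia.
move=> [g h].
(* N i is the contribution of a fibre of D2' at height - i. *)
pose N (i : H) := if odd i then #|D1| - diff_count D1 D2 g else diff_count D1 D2 g.
have slice a : #|[set x in D1 | (x - g \in D2)%R == ~~ odd (h - a : H)%R]| = N (h - a)%R.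
  rewrite /N; case: (odd _) => /=.
    rewrite -(cardsID [set x | (x - g)%R \in D2] D1) /diff_count.
    rewrite [X in X + _ - _](_ : _ = diff_count D1 D2 g); last first.
      by apply: eq_card => x; rewrite !inE.
    by rewrite addKn; apply: eq_card => x; rewrite !inE eqbF_neg andbC.
  by apply: eq_card => x; rewrite !inE eqb_id.
have -> : diff_count (setX D1 E1) D2' (g, h) = N h + N (h - 1)%R.
  rewrite -[h in N h]subr0 -!slice /diff_count -!sum1_card.
  rewrite (eq_bigl (fun z : G * H => (z.1 \in D1) && (z.2 \in E1) &&
     ((z.1 - g \in D2)%R == ~~ odd (h - z.2 : H)%R))); last first.
    by case=> x a; rewrite -(opprB a h) !inE /=.
  rewrite big_mkcond /= -(pair_bigA _ (fun x a => if (x \in D1) && (a \in E1) &&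
     ((x - g \in D2)%R == ~~ odd (h - a : H)%R) then 1 else 0)) /= exchange_big /=.
  rewrite (bigD1 0%R) // (bigD1 1%R) //= [X in _ + (_ + X)]big1 ?addn0.
    by congr (_ + _); rewrite [RHS]big_mkcond; apply: eq_bigr => x _;
      rewrite !inE ?eqxx ?orbT ?andbT.
  move=> a /andP[/negPf a0 /negPf a1]; apply: big1 => x _.
  by rewrite !inE a0 a1 /= andbF.
rewrite /N cD1 cD -[(g, h) == 0%R]/((g == 0%R) && (h == 0%R)).
(* With p = q + 2 odd, the residues 0 and -1 = p - 1 are both even, so [h = 0] gives twice the old
   count at [g]. For other [h], the parities of [h] and [h - 1] differ, and a count and its
   complement add up to [#|D1|]. *)
have [h0|hN0] := eqVneq h 0%R.
  rewrite h0 sub0r.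
  have -> : odd (- 1 : H)%R = false.
    by rewrite /= modn_small ?subSS ?subn0 //=; apply/negbTE.
  by rewrite andbT /=; case: (g == 0%R); lia.
have -> : odd (h - 1 : H)%R = ~~ odd h.
  case: h {slice} hN0 => [[|h] hlt] // _ /=.
  rewrite (modn_small (m := 1)) // subn1 (modn_small (m := q.+1)) //.
  by rewrite addSnnS modnDr modn_small ?negbK // ltnW.
rewrite andbF; case: (odd h) => /=; case: (g == 0%R); lia.
Qed.

Local Open Scope ring_scope.

(** * Flat pairs from sign functions with autocorrelation -1 *)

Lemma card_setE (T : finType) (P : pred T) :
  (#|[set x | P x]|%:Z = \sum_x (P x)%:R)%R.
Proof.
rewrite -natz -sum1_card natr_sum [LHS]big_mkcond /=; apply: eq_bigr => x _.
by rewrite inE; case: (P x).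
Qed.

Lemma flat_pair_of_signs (G : finZmodType) (m : nat) (f : G -> int) :
  (forall x, f x = 1 \/ f x = -1) -> (#|G| + 1 = 4 * m)%N ->
  (forall g, g != 0 -> \sum_x f x * f (x - g) = -1) ->
  exists D1 D2 : {set G}, flat_pair m D1 D2.
Proof.
move=> f1 cG fC; pose S := \sum_x f x.
(* Summing the autocorrelation over all shifts gives S^2 = v - (v - 1) = 1 with v = [#|G|], and
   replacing [f] by [- f] fixes the sign. With S = -1 the level set of -1 has (v + 1) / 2 = 2m
   elements. *)
wlog SE : f f1 fC @S / S = -1 => [IH|].
  have S2 : S * S = 1.
    have -> : S * S = \sum_g \sum_x f x * f (x - g).
      rewrite exchange_big mulr_suml; apply: eq_bigr => x _.
      by rewrite mulr_sumr (reindex_inj (inv_inj (subKr x))).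
    rewrite (bigD1 0) //= [X in _ + X](eq_bigr (fun=> -1)) => [|g g0]; last exact: fC.
    rewrite [X in X + _](eq_bigr (fun=> 1)) => [|x _]; last first.
      by rewrite subr0; case: (f1 x) => ->.
    by rewrite [X in X + _](bigD1 0) //= sumrN addrK.
  have /orP[/eqP S1|/eqP SN] : (S == 1) || (S == -1).
  - by rewrite -sqrf_eq1 expr2 S2.
  - apply: (IH (fun x => - f x)) => [x|g g0|].
    + by case: (f1 x) => ->; [right|left].
    + by rewrite -(fC g g0); apply: eq_bigr => x _; rewrite mulrNN.
    + by rewrite sumrN -/S S1.
  - exact: (IH f).
have cGZ : (#|G|%:Z = 4 * m%:Z - 1)%R by lia.
have sum1G : \sum_(x : G) (1 : int) = 4 * m%:Z - 1 by rewrite -cGZ sumr_const natz.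
(* The indicators of the level sets are (1 - f) / 2 and (1 + f) / 2, so four times the difference
   count is the sum of (1 - f x) (1 + f (x - g)). *)
have f2 x : ((f x == -1)%:R * 2 = 1 - f x :> int)%R by case: (f1 x) => ->.
have f3 x : ((f x == 1)%:R * 2 = 1 + f x :> int)%R by case: (f1 x) => ->.
exists [set x | f x == -1], [set x | f x == 1]; split.
  suff : (#|[set x | f x == -1]|%:Z * 2 = 4 * m%:Z)%R by lia.
  rewrite card_setE mulr_suml (eq_bigr _ (fun x _ => f2 x)) sumrB sum1G -/S SE; lia.
move=> g; have [->|gN0] := eqVneq g 0.
  apply: eq_card0 => x; rewrite !inE subr0; case: (f1 x) => -> //.
suff : (diff_count [set x | f x == -1] [set x | f x == 1] g)%:Z * 4 = 4 * m%:Z by lia.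
rewrite /diff_count card_setE mulr_suml.
rewrite (eq_bigr (fun x => 1 - f x + f (x - g) - f x * f (x - g))) => [|x _]; last first.
  rewrite !inE; have := f2 x; have := f3 (x - g).
  by case: (f1 x) => ->; case: (f1 (x - g)) => ->.
rewrite sumrB big_split /= sumrB sum1G fC // -/S SE.
rewrite (_ : \sum_x f (x - g) = -1); first by ring.
by rewrite -SE /S [RHS](reindex_inj (addIr (- g))).
Qed.

(** * The quadratic character of a finite field of odd order *)

Section QuadraticCharacter.
Variable F : finFieldType.
Hypothesis oddF : odd #|F|.
Implicit Types x y g : F.

(** Euler's criterion serves as the definition; values lie in [int], so that character sums are not
    reduced modulo the characteristic. *)
Definition quad_char (x : F) : int :=
  if x == 0 then 0 else if x ^+ (#|F|.-1)./2 == 1 then 1 else -1.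

Let k := (#|F|.-1)./2.

Lemma one_neqN1 : (1 : F) != -1.
Proof.
apply/eqP => oneN1; have: (#[1%R : F]%g %| 2)%N.
  by rewrite order_dvdn zmodXgE mulr2n {1}oneN1 addNr.
have: (#[1%R : F]%g %| #|F|)%N by rewrite -cardsT order_dvdG ?inE.
move=> dF d2; have: (#[1%R : F]%g %| 1)%N.
  by rewrite -(eqP (_ : coprime 2 #|F|)) ?dvdn_gcd ?dF ?d2 // coprime2n.
by rewrite dvdn1 order_eq1 zmod1gE oner_eq0.
Qed.

Lemma half_order : (k * 2 = #|F|.-1)%N.
Proof. by rewrite /k; have := oddF; lia. Qed.

Lemma expf_half x : x != 0 -> x ^+ k = 1 \/ x ^+ k = -1.
Proof.
move=> x0; apply/pred2P; rewrite /= -sqrf_eq1 -exprM half_order.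
apply/eqP/(mulfI x0); rewrite mulr1 -exprS prednK ?expf_card //.
by rewrite ltnW ?finNzRing_gt1.
Qed.

Lemma quad_char0 : quad_char 0 = 0. Proof. by rewrite /quad_char eqxx. Qed.

Lemma quad_char1 : quad_char 1 = 1.
Proof. by rewrite /quad_char oner_eq0 expr1n eqxx. Qed.

Lemma quad_char_sign x : x != 0 -> quad_char x = 1 \/ quad_char x = -1.
Proof. by rewrite /quad_char => /negPf ->; case: ifP; [left|right]. Qed.

Lemma quad_charM x y : quad_char (x * y) = quad_char x * quad_char y.
Proof.
rewrite /quad_char mulf_eq0; case: eqVneq => [_|x0] /=; first by rewrite mul0r.
case: eqVneq => [_|y0] /=; first by rewrite mulr0.
rewrite exprMn; have N1 : (-1 == 1 :> F) = false by rewrite eq_sym (negPf one_neqN1).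
by case: (expf_half x0) => ->; case: (expf_half y0) => ->;
  rewrite ?mulrNN ?mulr1 ?mul1r ?eqxx ?N1.
Qed.

Lemma quad_charN1 : quad_char (-1) = (-1) ^+ k.
Proof.
rewrite /quad_char oppr_eq0 oner_eq0 -/k.
rewrite -[X in if X == 1 then _ else _]signr_odd -[RHS]signr_odd.
by case: (odd k); rewrite ?eqxx // expr1 eq_sym (negPf one_neqN1).
Qed.

(** A nonsquare [a] exists, as otherwise all [#|F| - 1] nonzero elements would be roots of X^k - 1,
    of half that degree. Multiplication by [a] permutes [F] and negates the sum. *)
Lemma sum_quad_char : \sum_x quad_char x = 0.
Proof.
have [a a0 qa] : exists2 a, a != 0 & quad_char a = -1.
  suff /exists_inP[a a0 /eqP qa] : [exists a in predC1 (0 : F), quad_char a == -1].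
    by exists a.
  apply: contraT => /exists_inPn noN1.
  have kE := half_order; have F1 := finNzRing_gt1 F.
  have: (size (enum (predC1 (0%R : F))) <= k)%N.
    apply: max_unity_roots; rewrite ?enum_uniq //.
      by move: kE F1; case: (k) => //; case: (#|F|) => [|[]].
    apply/allP => x; rewrite mem_enum => x0; apply/unity_rootP.
    have := noN1 x x0; rewrite /quad_char (negPf x0) -/k.
    by case: (x ^+ k =P 1) => // _; rewrite eqxx.
  rewrite -cardE cardC1 -kE; move: kE F1; case: (k) => [|k0]; last by move=> *; lia.
  by case: (#|F|) => [|[]].
suff : \sum_x quad_char x = - \sum_x quad_char x by lia.
rewrite {1}(reindex_inj (mulfI a0)) -sumrN; apply: eq_bigr => x _.
by rewrite quad_charM qa mulN1r.
Qed.

Lemma quad_char_corr g :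
  \sum_x quad_char x * quad_char (x - g) = #|F|%:Z * (g == 0)%:R - 1.
Proof.
have cF : \sum_(x : F | x != 0) (1 : int) = #|F|%:Z - 1.
  have : \sum_(x : F) (1 : int) = #|F|%:Z by rewrite sumr_const natz.
  by rewrite (bigD1 0) //= => <-; rewrite addrC addrK.
rewrite (bigD1 0) //= quad_char0 mul0r add0r.
have [->|g0] := eqVneq g 0.
  rewrite mulr1 -cF; apply: eq_bigr => x x0; rewrite subr0.
  by case: (quad_char_sign x0) => ->.
(* For x <> 0, chi x * chi (x - g) = chi (1 - g / x), and u = 1 - g / x ranges over
   everything but 1. *)
rewrite mulr0 sub0r; have <- : \sum_(u | u != 1) quad_char u = -1.
  by have := sum_quad_char; rewrite (bigD1 1) //= quad_char1 => /(canRL (addKr _)).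
pose h x := 1 - g / x; pose h' u := g / (1 - u).
rewrite [RHS](reindex_onto h h') => [|u u1]; last first.
  by rewrite /h /h' invf_div mulrCA divff // mulr1 subKr.
apply: eq_big => [x|x x0].
  (* Since the inverse of 0 is 0, [h' (h x) = x] holds at [x = 0] too; there [h x = 1], so excluding
     1 on one side matches excluding 0 on the other. *)
  rewrite /h /h' subKr invf_div mulrCA divff // mulr1 eqxx andbT.
  by rewrite -(subr_eq0 _ 1) addrAC subrr add0r oppr_eq0 mulf_eq0 invr_eq0 (negPf g0).
have -> : x - g = x * h x by rewrite mulrBr mulr1 mulrCA divff // mulr1.
rewrite quad_charM mulrA; case: (quad_char_sign x0) => ->; rewrite ?mul1r //.
Qed.

End QuadraticCharacter.

(** * The two base cases: prime powers and twin prime powers *)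

Lemma prime_power_field (q : nat) :
  prime_power q -> exists F : finFieldType, #|F| = q.
Proof.
by case=> p [k [pp k0 ->]]; have [F _ cF] := pPrimePowerField pp k0; exists F.
Qed.

Lemma flat_pair_paley (m : nat) : (0 < m)%N -> prime_power (4 * m - 1) ->
  exists (G : finZmodType) (D1 D2 : {set G}),
    #|G| = (4 * m - 1)%N /\ flat_pair m D1 D2.
Proof.
move=> m0 /prime_power_field[F cF].
have oddF : odd #|F| by rewrite cF; lia.
pose f x := quad_char x + (x == 0 :> F)%:R.
(* As [#|F|] is 3 modulo 4, the character is odd, so the cross terms at [g] and [- g] caused by
   setting [f 0 = 1] cancel. *)
have qN (x : F) : quad_char (- x) = - quad_char x.
  rewrite -[- x]mulN1r quad_charM // quad_charN1 // -signr_odd.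
  have -> : odd (#|F|.-1)./2 by rewrite cF; lia.
  by rewrite expr1 mulN1r.
have [||g g0|D1 [D2 D12]] := @flat_pair_of_signs F m f; last by exists F, D1, D2.
- by move=> x; rewrite /f; case: eqVneq => [->|/quad_char_sign[]->];
    rewrite ?quad_char0; [left|left|right].
- by rewrite cF; lia.
have -> : \sum_x f x * f (x - g) = \sum_x (quad_char x * quad_char (x - g)
   + (quad_char x * (x == g)%:R + (x == 0)%:R * quad_char (x - g))).
  apply: eq_bigr => x _; rewrite /f subr_eq0; have [->|_] := eqVneq x 0 => /=;
    last by ring.
  by rewrite eq_sym (negPf g0) /=; ring.
rewrite !big_split /= quad_char_corr // (negPf g0) mulr0.
rewrite (bigD1 g) //= eqxx big1 => [|x /negPf ->]; last by rewrite mulr0.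
rewrite (bigD1 0) //= eqxx big1 => [|x /negPf ->]; last by rewrite mul0r.
by rewrite !sub0r qN !addr0 mulr1 mul1r subrr addr0.
Qed.

Lemma flat_pair_twin (m q : nat) :
  (4 * m - 1 = q * (q + 2))%N -> (0 < m)%N ->
  prime_power q -> prime_power (q + 2) ->
  exists (G : finZmodType) (D1 D2 : {set G}),
    #|G| = (4 * m - 1)%N /\ flat_pair m D1 D2.
Proof.
move=> mq m0 /prime_power_field[F cF] /prime_power_field[K cK].
have oddq : odd q.
  have : odd (q * (q + 2)) by rewrite -mq; lia.
  by rewrite oddM => /andP[].
have oddF : odd #|F| by rewrite cF.
have oddK : odd #|K| by rewrite cK; lia.
pose e (T : finFieldType) (x : T) : int := (x == 0)%:R.
(* [f] is the product character off the axes, 1 where the second coordinate vanishes (origin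
   included), and -1 on the rest of the other axis. *)
pose f (z : F * K) : int :=
  quad_char z.1 * quad_char z.2 + e K z.2 - e F z.1 + e F z.1 * e K z.2.
(* The exponents (q - 1) / 2 and (q + 1) / 2 are consecutive, so exactly one of the two characters
   is odd. *)
have qN (x : F) (y : K) : quad_char (- x : F) * quad_char (- y : K) =
    - (quad_char x * quad_char y).
  rewrite -[- x]mulN1r -[- y]mulN1r !quad_charM // !quad_charN1 //.
  have -> : (#|K|.-1./2 = #|F|.-1./2.+1)%N by rewrite cF cK; lia.
  rewrite exprS; have := sqrr_sign int #|F|.-1./2; set s := (-1) ^+ _ => s2.
  transitivity (- (s ^+ 2 * (quad_char x * quad_char y))); first by ring.
  by rewrite s2 mul1r.
have [||[g h] gh0|D1 [D2 D12]] := @flat_pair_of_signs (F * K)%type m f;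
    last by exists (F * K)%type, D1, D2; split=> //; rewrite card_prod cF cK.
- case=> x y; rewrite /f /e /=.
  case: (eqVneq x 0) => [->|/quad_char_sign x1];
    case: (eqVneq y 0) => [->|/quad_char_sign y1]; rewrite ?quad_char0 /=.
  + by left.
  + by right; ring.
  + by left; ring.
  by case: x1 => ->; case: y1 => ->; [left|right|right|left].
- by rewrite card_prod cF cK; lia.
(* [f] is a combination of four products of one-variable functions, and the correlation of two such
   products factors; sixteen terms in one-variable correlations [C] result. *)
pose C (T : finFieldType) (u w : T -> int) (a : T) := \sum_x u x * w (x - a).
have CE (u u' : F -> int) (w w' : K -> int) :
  \sum_z (u z.1 * w z.2) * (u' (z.1 - g) * w' (z.2 - h)) = C F u u' g * C K w w' h.
  rewrite /C mulr_suml -(pair_bigA _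
    (fun x y => (u x * w y) * (u' (x - g) * w' (y - h)))) /=.
  by apply: eq_bigr => x _; rewrite mulr_sumr; apply: eq_bigr => y _; ring.
have sumN (T : finFieldType) (oddT : odd #|T|) (a : T) : \sum_x quad_char (x - a) = 0.
  by rewrite -[RHS](sum_quad_char oddT) [RHS](reindex_inj (addIr (- a))).
have Cee (T : finFieldType) (u : T -> int) a : C T u (e T) a = u a.
  rewrite /C (bigD1 a) //= /e subrr eqxx mulr1 big1 ?addr0 // => x xa.
  by rewrite subr_eq0 (negPf xa) mulr0.
have Ceu (T : finFieldType) (u : T -> int) a : C T (e T) u a = u (- a).
  rewrite /C (bigD1 0) //= /e sub0r eqxx mul1r big1 ?addr0 // => x x0.
  by rewrite (negPf x0) mul0r.
pose one (T : finFieldType) (x : T) : int := 1.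
have Cq1 (T : finFieldType) a : odd #|T| -> C T (@quad_char T) (one T) a = 0.
  by move=> oddT; rewrite /C -mulr_suml sum_quad_char // mul0r.
have C1q (T : finFieldType) a : odd #|T| -> C T (one T) (@quad_char T) a = 0.
  by move=> oddT; rewrite /C -mulr_sumr sumN // mulr0.
have C11 (T : finFieldType) a : C T (one T) (one T) a = #|T|%:Z.
  by rewrite /C (eq_bigr (fun=> 1)) ?sumr_const ?natz.
have Cqq (T : finFieldType) a : odd #|T| ->
  C T (@quad_char T) (@quad_char T) a = #|T|%:Z * e T a - 1.
  by move=> oddT; rewrite /C quad_char_corr.
pose qF := @quad_char F; pose qK := @quad_char K.
have right_expand (u : F -> int) (w : K -> int) :
    \sum_z u z.1 * w z.2 * f (z - (g, h)) =
    C F u qF g * C K w qK h + C F u (one F) g * C K w (e K) h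
    - C F u (e F) g * C K w (one K) h + C F u (e F) g * C K w (e K) h.
  rewrite -!CE -big_split -sumrB -big_split; apply: eq_bigr => z _.
  by rewrite /f /one /=; ring.
have -> : \sum_z f z * f (z - (g, h)) =
    \sum_z qF z.1 * qK z.2 * f (z - (g, h))
    + \sum_z one F z.1 * e K z.2 * f (z - (g, h))
    - \sum_z e F z.1 * one K z.2 * f (z - (g, h))
    + \sum_z e F z.1 * e K z.2 * f (z - (g, h)).
  rewrite -big_split -sumrB -big_split; apply: eq_bigr => z _.
  by rewrite [f z]/f /one /=; ring.
rewrite !right_expand !Cqq // !Cee !Ceu !Cq1 // !C1q // !C11 cF cK.
have := qN g h; rewrite -/(qF _) -/(qK _) => qgh.
rewrite /one.
have: e F g * e K h = 0.
  by move: gh0; rewrite /e -[(g, h) == 0]/((g == 0) && (h == 0)); do 2!case: (_ == _).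
rewrite qgh PoszD => egh.
(* The terms linear in [e F g] or [e K h] cancel because [#|K| = #|F| + 2]. *)
transitivity ((q%:Z * (q%:Z + 2) + 1) * (e F g * e K h) - 1); first by ring.
by rewrite egh mulr0 sub0r.
Qed.

Local Close Scope ring_scope.

(** * Iterated lifting and the final parameters *)

Lemma flat_pair_prod (n : nat) (p : 'I_n -> nat) (G : finZmodType) (lambda : nat)
    (D1 D2 : {set G}) :
  (forall i : 'I_n, odd (p i) /\ 1 < p i) -> flat_pair lambda D1 D2 ->
  exists (G' : finZmodType) (D1' D2' : {set G'}),
    #|G'| = #|G| * \prod_(i < n) p i /\ flat_pair (lambda * 2 ^ n) D1' D2'.
Proof.
elim: n => [|n IHn] in p * => p_odd D12.
  by exists G, D1, D2; rewrite big_ord0 !muln1.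
have [|G' [D1' [D2' [cG' D12']]]] := IHn (fun i => p (widen_ord (leqnSn n) i)) _ D12.
  by move=> i; apply: p_odd.
have [pn pn1] := p_odd ord_max.
have [G2 [E1 [E2 [cG2 E12]]]] := flat_pair_step pn pn1 D12'.
exists G2, E1, E2; split; first by rewrite cG2 cG' big_ord_recr mulnA.
by rewrite expnS mulnCA.
Qed.

Theorem theorem4p11 (m n t : nat)
    (ht : (t = 1 /\ n = 0) \/
          (1 <= n /\ exists p : 'I_n -> nat,
             (forall i : 'I_n, odd (p i) /\ 1 < p i) /\
             t = \prod_(i < n) p i))
    (hm0 : 0 < m)
    (hm : prime_power (4 * m - 1) \/
          exists q : nat, [/\ 4 * m - 1 = q * (q + 2), prime_power q
                            & prime_power (q + 2)]) :
  exists (G : finZmodType) (D1 D2 : {set G}),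
    is_GSEDF ((4 * m - 1) * t)
             (m * 2 ^ n.+1) ((4 * m * t - t - 1) %/ 2)
             (m * 2 ^ n) (m * 2 ^ n) D1 D2.
Proof.
have [G0 [E1 [E2 [cG0 E12]]]] : exists (G : finZmodType) (D1 D2 : {set G}),
    #|G| = 4 * m - 1 /\ flat_pair m D1 D2.
  case: hm => [|[q [mq qF qK]]]; first exact: flat_pair_paley.
  exact: flat_pair_twin mq hm0 qF qK.
have [p [p_odd tE]] : exists p : 'I_n -> nat,
    (forall i, odd (p i) /\ 1 < p i) /\ t = \prod_(i < n) p i.
  (* For [n = 0] the index type is empty, so any odd constant above 1 serves, and the empty product
     is [t = 1]. *)
  case: ht => [[-> n0]|[_]//]; exists (fun=> 3); split=> //.
  by rewrite n0 big_ord0.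
have t0 : 0 < t.
  by rewrite tE prodn_gt0 // => i; have [_ /ltnW] := p_odd i.
have [G [D1 [D2 [cG D12]]]] := flat_pair_prod p_odd E12.
rewrite -tE cG0 in cG.
exists G, D1, D2; rewrite expnS mulnCA -cG.
have -> : 4 * m * t - t = #|G| by rewrite cG mulnBl mul1n.
apply: flat_pair_GSEDF => //; first by rewrite muln_gt0 hm0 expn_gt0.
by rewrite cG; nia.
Qed.
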